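(* For an infinite binary sequence $\{b_k\}_{k\ge0}$ (each $b_k\in\{0,1\}$), let $f_{\{b_k\}}$ be the associated limit function on the open unit disk, with its Maclaurin series. Then no two distinct binary sequences produce the same power series: if $\{b_k\}_{k\geq 0}$ and $\{b'_k\}_{k\ge 0}$ are binary sequences with $b_k\neq b'_k$ for some $k$, then the Maclaurin series of $f_{\{b_k\}}$ and $f_{\{b'_k\}}$ are different.
   Context: The Stern polynomials $\{a(n;z)\}_{n\ge 0}$ are defined recursively by $a(0;z)=0$, $a(1;z)=1$, and, for $n\geq 1$, $a(2n;z)=a(n;z^2)$ and $a(2n+1;z)=z\,a(n;z^2)+a(n+1;z^2)$. For a binary sequence $\{b_k\}_{k\ge0}$, the function $f_{\{b_k\}}$ is the analytic function on $\{|z|<1\}$ given by \[ f_{\{b_k\}}(z)=\lim_{m\to\infty} a\left(2^{m+1}n+\sum_{j=0}^m 2^j b_j\,;\,z\right), \] where the limit exists and is independent of the choice of the integer $n>0$. *)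

(* Defs.v *)
From HB Require Import structures.
From mathcomp Require Import all_boot all_order all_algebra.
From mathcomp Require Import complex.
From mathcomp Require Import mathcomp_extra boolp classical_sets functions.
From mathcomp Require Import reals topology normedtype sequences derive.
Set Implicit Arguments.
Unset Strict Implicit.
Unset Printing Implicit Defensive.
Import Order.TTheory GRing.Theory Num.Theory.
Import numFieldNormedType.Exports.
Local Open Scope classical_set_scope.
Local Open Scope ring_scope.

(* [k] is fuel for the recursion on [n]; any [k >= n] gives the same value. *)
Fixpoint stern_rec (A : nzRingType) (k n : nat) : {poly A} :=
  if k is k'.+1 then
    if (n <= 1)%N then n%:R
    else if odd n then
      'X * (stern_rec A k' n./2 \Po 'X^2) + (stern_rec A k' n./2.+1 \Po 'X^2)
    else stern_rec A k' n./2 \Po 'X^2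
  else 0.

Definition stern (A : nzRingType) (n : nat) : {poly A} := stern_rec A n n.

Lemma stern_recSS (A : nzRingType) (k n : nat) :
  stern_rec A k.+1 n.+2 =
    if odd n then
      'X * (stern_rec A k n./2.+1 \Po 'X^2) + (stern_rec A k n./2.+2 \Po 'X^2)
    else stern_rec A k n./2.+1 \Po 'X^2.
Proof. by rewrite /= negbK. Qed.

Lemma stern_rec_fuel (A : nzRingType) (k n : nat) :
  (n <= k)%N -> stern_rec A k n = stern A n.
Proof.
rewrite /stern; have [l le_nl] := ubnP n.
elim: l => // l IHl in n le_nl k *.
case: k => [|k]; first by case: n le_nl.
case: n le_nl => [|[|n]] // le_nl le_nk.
have E m : (m <= n)%N -> stern_rec A k m.+1 = stern_rec A n.+1 m.+1.
  move=> le_mn; have lt_ml : (m.+1 < l)%N.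
    by apply: leq_ltn_trans (_ : (n.+1 < l)%N).
  by rewrite !(IHl m.+1) //; apply: leq_ltn_trans le_mn _.
have half_n : (n./2 <= n)%N.
  by rewrite -{2}(odd_double_half n) -addnn addnA leq_addl.
rewrite [LHS]stern_recSS [RHS]stern_recSS (E _ half_n); case: ifP => // odd_n.
have lt_half : (n./2 < n)%N.
  by rewrite -{2}(odd_double_half n) odd_n add1n ltnS -addnn leq_addl.
by rewrite (E _ lt_half).
Qed.

Lemma stern0 (A : nzRingType) : stern A 0 = 0.
Proof. by []. Qed.

Lemma stern1 (A : nzRingType) : stern A 1 = 1.
Proof. by []. Qed.

Lemma stern_even (A : nzRingType) (n : nat) :
  (0 < n)%N -> stern A n.*2 = stern A n \Po 'X^2.
Proof.
case: n => // n _; rewrite {1}/stern doubleS stern_recSS odd_double doubleK.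
by rewrite stern_rec_fuel // ltnS -addnn leq_addr.
Qed.

Lemma stern_odd (A : nzRingType) (n : nat) : (0 < n)%N ->
  stern A n.*2.+1 = 'X * (stern A n \Po 'X^2) + (stern A n.+1 \Po 'X^2).
Proof.
case: n => // n _; have le_n : (n <= n.*2)%N by rewrite -addnn leq_addr.
have half_n : n.*2.+1./2 = n by rewrite /= uphalf_double.
rewrite {1}/stern doubleS stern_recSS oddS odd_double half_n.
by rewrite (stern_rec_fuel A (leqW _ : n.+1 <= _)%N) // stern_rec_fuel.
Qed.

Definition stern_index (b : nat -> bool) (n m : nat) : nat :=
  (2 ^ m.+1 * n + \sum_(j < m.+1) 2 ^ j * b j)%N.

(* [R[i]^o] is [R[i]] as a normed space over itself. The value at [z] is the
   limit of a(2^(m+1) n + sum_(j <= m) 2^j b_j ; z) as m tends to infinity, the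
   same for every n > 0; it is meant for |z| < 1, and arbitrary wherever there
   is no such common limit. *)
Definition stern_lim (R : realType) (b : nat -> bool) (z : R[i]) : R[i]^o :=
  get [set w : R[i]^o | forall n : nat, (0 < n)%N ->
    (fun m => (stern R[i] (stern_index b n m)).[z] : R[i]^o) @ \oo --> w].

(* The k-th coefficient f^(k)(0) / k! of the Maclaurin series of [f]; the scalar
   field being [R[i]], [derive1n] iterates the complex derivative. *)
Definition maclaurin (R : realType) (f : R[i] -> R[i]^o) (k : nat) : R[i] :=
  derive1n k f 0 / k`!%:R.

(* Main.v *)
Require Import Defs.
From mathcomp Require Import all_boot all_order all_algebra complex.
From mathcomp Require Import boolp classical_sets reals topology normedtype.
From mathcomp Require Import sequences derive.
From mathcomp Require Import ring lra zify.
Set Implicit Arguments.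
Unset Strict Implicit.
Unset Printing Implicit Defensive.
Import Order.TTheory GRing.Theory Num.Theory.
Import numFieldNormedType.Exports.
Local Open Scope classical_set_scope.
Local Open Scope ring_scope.

(** Write S b for the sequence b with its first bit removed, and f_b for the
    limit function of b. The Stern recursion, passed to the limit, says that
    f_b(z) = f_(S b)(z^2) when b_0 = 0, and that the odd part of f_b is
    z f_(S b)(z^2) when b_0 = 1. Since f_(S b)(0) = 1, the coefficient of z in
    f_b is b_0; in both cases the Maclaurin series of f_(S b) can then be read
    off from that of f_b, as its even or odd half. So the series determines
    b_0, then b_1, and so on ([stern_coef_inj]).

    This argument needs no analysis once the Maclaurin coefficients of f_b are
    known to be the limits of the coefficients of the Stern polynomials. These
    coefficients are 0 or 1, and for indices at least 2^j those of degree below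
    2^j depend only on the residue of the index modulo 2^j ([coef_stern_mod]),
    so that along the indices defining f_b they are eventually constant, with
    values [stern_coef]. On the unit disk the polynomials therefore converge to the
    sum of the power series with these coefficients ([psum_stern_lim]), the
    error being at most a tail of the geometric series.

    There remains termwise differentiation of complex power series. Coefficient
    sequences dominated by a binomial C(k+p, p) are stable under formal
    differentiation, and their series are dominated by the expansion of
    (1-r)^-(p+1). A second order Taylor estimate, uniform in the length of the
    partial sums, then shows that the sum is differentiable with the expected
    derivative ([derive1_pseries]), and iterating this at 0 gives the Maclaurin
    coefficients ([maclaurin_pseries]). *)

(** * Coefficients of Stern polynomials *)

Section SternCoef.
Variable A : nzRingType.
Implicit Types (n k : nat) (b : nat -> bool).

Lemma coef_stern_even n k : (0 < n)%N ->
  (stern A n.*2)`_k = if odd k then 0 else (stern A n)`_k./2.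
Proof.
move=> n0; rewrite stern_even // coef_comp_poly_Xn // dvdn2 -divn2.
by case: odd.
Qed.

Lemma coef_stern_odd n k : (0 < n)%N ->
  (stern A n.*2.+1)`_k = (stern A (if odd k then n else n.+1))`_k./2.
Proof.
move=> n0; rewrite stern_odd // coefD coefXM !coef_comp_poly_Xn // !dvdn2.
case: k => [|k] /=; first by rewrite add0r.
by rewrite negbK !divn2 /= uphalf_half; case: odd; rewrite /= ?addr0 ?add0r.
Qed.

Lemma coef0_stern n : (0 < n)%N -> (stern A n)`_0 = 1.
Proof.
elim/ltn_ind: n => n IHn n0.
have [->|n1] := eqVneq n 1; first by rewrite stern1 coef1.
rewrite -(odd_double_half n); case odd_n: (odd n); rewrite /= ?add0n ?add1n.
  by rewrite coef_stern_odd ?IHn //; lia.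
by rewrite coef_stern_even ?IHn //; lia.
Qed.

Lemma coef_stern_01 n k : (stern A n)`_k = 0 \/ (stern A n)`_k = 1.
Proof.
elim/ltn_ind: n k => n IHn k.
have [->|n0] := eqVneq n 0; first by left; rewrite stern0 coef0.
have [->|n1] := eqVneq n 1.
  by rewrite stern1 coef1; case: eqP; [right|left].
rewrite -(odd_double_half n); case odd_n: (odd n); rewrite /= ?add0n ?add1n.
  by rewrite coef_stern_odd; [apply: IHn; case: ifP|]; lia.
rewrite coef_stern_even; last by lia.
by case: ifP => _; [left | apply: IHn; lia].
Qed.

(** By induction on [j]: the recursion halves the index, its residue and the
    degree together. The residue [2 ^ j] itself is included because the odd
    step of the recursion also uses the next index, and so may carry. *)
Lemma coef_stern_mod j n n' l k : (0 < n)%N -> (0 < n')%N ->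
  (l <= 2 ^ j)%N -> (k < 2 ^ j)%N ->
  (stern A (2 ^ j * n + l))`_k = (stern A (2 ^ j * n' + l))`_k.
Proof.
move=> n0 n'0; elim: j l k => [|j IHj] l k.
  by rewrite ltnS leqn0 => _ /eqP->; rewrite !coef0_stern //; lia.
rewrite expnS => le_l lt_k.
have E m : (2 * 2 ^ j * m + l = odd l + (2 ^ j * m + l./2).*2)%N.
  by rewrite -{1}(odd_double_half l); lia.
have pos m : (0 < m)%N -> (0 < 2 ^ j * m + l./2)%N by have := expn_gt0 2 j; lia.
have lt_k2 : (k./2 < 2 ^ j)%N by lia.
rewrite !E; case odd_l: (odd l); rewrite /= ?add0n ?add1n.
  rewrite !coef_stern_odd ?pos // -!addnS.
  by case: ifP => _; apply: IHj => //; lia.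
by rewrite !coef_stern_even ?pos //; case: ifP => // _; apply: IHj => //; lia.
Qed.

Lemma stern_index_gt0 b n m : (0 < n)%N -> (0 < stern_index b n m)%N.
Proof. by move=> n0; rewrite /stern_index; have := expn_gt0 2 m.+1; lia. Qed.

Lemma ltn_exp2 k m : (k <= m)%N -> (k < 2 ^ m)%N.
Proof.
by move=> le_km; apply: leq_trans (ltn_expl _ _) (leq_pexp2l _ le_km).
Qed.

Lemma sum_bits_lt b m : (\sum_(j < m) 2 ^ j * b j < 2 ^ m)%N.
Proof.
elim: m => [|m IHm]; first by rewrite big_ord0.
rewrite big_ord_recr /= expnS; move: IHm; set s := (\sum_(_ < _) _)%N.
by case: (b m); rewrite ?muln1 ?muln0; lia.
Qed.

Lemma stern_indexS b n m :
  stern_index b n m.+1 = (b 0%N + (stern_index (fun j => b j.+1) n m).*2)%N.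
Proof.
rewrite /stern_index big_ord_recl /= mul1n expnS -mulnA doubleD -!mul2n.
rewrite [RHS]addnCA; congr addn; congr addn; rewrite big_distrr /=.
by apply: eq_bigr => i _; rewrite expnS mulnA.
Qed.

(** The bits beyond position [m] only change the integer above the first
    [m.+1] bits, which is arbitrary in the definition of the limit. *)
Lemma stern_index_addn b n m d : (0 < n)%N ->
  exists2 n', (0 < n')%N & stern_index b n (m + d) = stern_index b n' m.
Proof.
elim: d n => [|d IHd] n n0; first by exists n; rewrite ?addn0.
have [|n' n'0 E] := IHd (2 * n + b (m + d).+1)%N; first by lia.
exists n' => //; rewrite -E /stern_index addnS big_ord_recr /= [in LHS]expnS.
by lia.
Qed.

(** The stable value of the coefficient of degree [k] along the indices that
    define the limit function of [b]: taking the bits up to position [k] is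
    enough, as [k < 2 ^ k.+1]. *)
Definition stern_coef b k : A := (stern A (stern_index b 1 k))`_k.

Lemma coef_stern_index b n m k : (0 < n)%N -> (k < 2 ^ m.+1)%N ->
  (stern A (stern_index b n m))`_k = stern_coef b k.
Proof.
move=> n0 lt_k; rewrite /stern_coef.
have stab n' n'' j : (0 < n')%N -> (0 < n'')%N -> (k < 2 ^ j.+1)%N ->
    (stern A (stern_index b n' j))`_k = (stern A (stern_index b n'' j))`_k.
  by move=> *; apply: coef_stern_mod => //; apply/ltnW/sum_bits_lt.
have [le_mk|/ltnW le_km] := leqP m k.
  have [n' n'0] := stern_index_addn b m (k - m) (ltn0Sn 0).
  by rewrite subnKC // => ->; apply: stab.
have [n' n'0] := stern_index_addn b k (m - k) n0.
by rewrite subnKC // => ->; apply: stab => //; apply: ltn_exp2.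
Qed.

Lemma stern_coef0 b : stern_coef b 0 = 1.
Proof. by rewrite /stern_coef coef0_stern // stern_index_gt0. Qed.

Lemma stern_coef_01 b k : stern_coef b k = 0 \/ stern_coef b k = 1.
Proof. exact: coef_stern_01. Qed.

(** The odd part of f_b is z f_(S b)(z^2) or 0, according to the first bit. *)
Lemma stern_coef_doubleS b k :
  stern_coef b k.*2.+1 = if b 0%N then stern_coef (fun j => b j.+1) k else 0.
Proof.
rewrite {1}/stern_coef stern_indexS; set i := stern_index _ _ _.
have i0 : (0 < i)%N by apply: stern_index_gt0.
case: (b 0%N); rewrite /= ?add1n ?add0n.
  rewrite coef_stern_odd //= odd_double /= uphalf_double.
  by apply: coef_stern_index => //; apply: ltn_exp2; lia.
by rewrite coef_stern_even //= odd_double.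
Qed.

Lemma stern_coef_double b k : b 0%N = false ->
  stern_coef b k.*2 = stern_coef (fun j => b j.+1) k.
Proof.
case: k => [|k] b0; first by rewrite !stern_coef0.
rewrite {1}/stern_coef doubleS stern_indexS b0 add0n.
rewrite coef_stern_even ?stern_index_gt0 //.
rewrite /= negbK odd_double /= doubleK.
by apply: coef_stern_index => //; apply: ltn_exp2; lia.
Qed.

Lemma stern_coef_first b b' : stern_coef b =1 stern_coef b' -> b 0%N = b' 0%N.
Proof.
move/(_ 1%N); rewrite !(stern_coef_doubleS _ 0) !stern_coef0.
by do 2!case: (_ 0%N) => //; move/eqP; rewrite ?oner_eq0 // eq_sym oner_eq0.
Qed.

(** The first bit is the coefficient of degree 1; it tells which half of the
    coefficients carries the series of the shifted sequence. *)
Lemma stern_coef_inj b b' : stern_coef b =1 stern_coef b' -> b =1 b'.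
Proof.
move=> E j; elim: j b b' E => [|j IHj] b b' E.
  exact: stern_coef_first.
have E0 := stern_coef_first E.
apply: (IHj (fun i => b i.+1) (fun i => b' i.+1)) => k.
have [b0|b0] := boolP (b 0%N).
  by have := E k.*2.+1; rewrite !stern_coef_doubleS -E0 b0.
by have := E k.*2; rewrite !stern_coef_double // -?E0 (negbTE b0).
Qed.

End SternCoef.

(** * Termwise differentiation of power series *)

Section PowerSeries.
Variable K : numFieldType.
Implicit Types (c : nat -> K) (z h r : K).

(** Domination by binomials rather than by powers of [k]: formal
    differentiation maps such a bound to another one exactly, and the dominating
    power series sums to (1-r)^-(p+1). *)
Definition poly_growth c :=
  exists p M, forall k, `|c k| <= M * 'C(k + p, p)%:R.

Definition psum c z n := \sum_(k < n) c k * z ^+ k.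

Definition diffs c k := k.+1%:R * c k.+1.

(** (k+1) C(k+1+p, p) = (p+1) C(k+p+1, p+1). *)
Lemma poly_growth_diffs c : poly_growth c -> poly_growth (diffs c).
Proof.
move=> [p [M cM]]; exists p.+1, (M * p.+1%:R) => k.
rewrite /diffs normrM normr_nat mulrC.
apply: le_trans (ler_wpM2r (ler0n _ _) (cM k.+1)) _.
by rewrite -!mulrA -!natrM mul_bin_left -addSnnS addnK mulnC.
Qed.

(** Pascal's rule turns multiplication by [1 - r] into lowering of [p], up to
    a boundary term that is nonnegative for [0 <= r]. *)
Lemma sum_bin_expr p n r :
  (1 - r) * \sum_(k < n) 'C(k + p.+1, p.+1)%:R * r ^+ k =
  \sum_(k < n) 'C(k + p, p)%:R * r ^+ k - 'C(n + p, p.+1)%:R * r ^+ n.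
Proof.
elim: n => [|n IHn].
  by rewrite !big_ord0 add0n bin_small // mul0r subr0 mulr0.
rewrite !big_ord_recr /= mulrDr IHn addSnnS addnS binS natrD exprS; ring.
Qed.

Lemma sum_bin_expr_le p n r : 0 <= r -> r < 1 ->
  \sum_(k < n) 'C(k + p, p)%:R * r ^+ k <= (1 - r)^-1 ^+ p.+1.
Proof.
move=> r0 r1; have r1' : 0 < 1 - r by rewrite subr_gt0.
elim: p => [|p IHp].
  rewrite expr1 -(ler_pM2l r1') divff ?gt_eqF //.
  under eq_bigr do rewrite bin0 mul1r.
  rewrite -(opprB r) mulNr -subrX1 opprB.
  by rewrite lerBlDr lerDl exprn_ge0.
rewrite -(ler_pM2l r1') sum_bin_expr exprS mulrA divff ?gt_eqF // mul1r.
by apply: le_trans IHp; rewrite lerBlDr lerDl mulr_ge0 ?exprn_ge0.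
Qed.

Lemma sum_norm_expr_le c p M z r n :
  (forall k, `|c k| <= M * 'C(k + p, p)%:R) ->
  `|z| <= r -> r < 1 ->
  \sum_(k < n) `|c k| * r ^+ k <= M * (1 - r)^-1 ^+ p.+1.
Proof.
move=> cM zr r1; have r0 : 0 <= r by apply: le_trans zr.
have M0 : 0 <= M.
  apply: le_trans (normr_ge0 (c 0%N)) _.
  by rewrite (le_trans (cM 0%N)) // add0n binn mulr1.
apply: le_trans (ler_wpM2l M0 (sum_bin_expr_le p n r0 r1)).
rewrite big_distrr /=; apply: ler_sum => k _; rewrite mulrA.
by rewrite ler_wpM2r ?exprn_ge0.
Qed.

Lemma expr_taylor2_le z h r k : `|z| <= r -> `|z + h| <= r ->
  `|(z + h) ^+ k.+2 - z ^+ k.+2 - k.+2%:R * h * z ^+ k.+1|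
    <= (k.+1 * k.+2)%:R * `|h| ^+ 2 * r ^+ k.
Proof.
move=> zr zhr; have r0 : 0 <= r by apply: le_trans zr.
have h0 := normr_ge0 h.
(* The sharp constant is C(k+2, 2), which is what the induction propagates. *)
suff : `|(z + h) ^+ k.+2 - z ^+ k.+2 - k.+2%:R * h * z ^+ k.+1|
    <= 'C(k.+2, 2)%:R * `|h| ^+ 2 * r ^+ k.
  move/le_trans; apply; rewrite ler_wpM2r ?exprn_ge0 // ler_wpM2r ?exprn_ge0 //.
  by rewrite ler_nat bin2 /=; lia.
elim: k => [|k IHk].
  have -> : (z + h) ^+ 2 - z ^+ 2 - 2 * h * z ^+ 1 = h ^+ 2 by ring.
  by rewrite binn mul1r mulr1 normrX.
have -> : (z + h) ^+ k.+3 - z ^+ k.+3 - k.+3%:R * h * z ^+ k.+2 =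
  (z + h) * ((z + h) ^+ k.+2 - z ^+ k.+2 - k.+2%:R * h * z ^+ k.+1) +
  k.+2%:R * h ^+ 2 * z ^+ k.+1.
  rewrite !(exprS _ k.+2) !(exprS _ k.+1) -[k.+3%:R]natr1; ring.
have -> : 'C(k.+3, 2)%:R * `|h| ^+ 2 * r ^+ k.+1 =
    r * ('C(k.+2, 2)%:R * `|h| ^+ 2 * r ^+ k) + k.+2%:R * `|h| ^+ 2 * r ^+ k.+1.
  by rewrite binS bin1 natrD (exprS r); ring.
apply: le_trans (ler_normD _ _) (lerD _ _).
  by rewrite normrM; apply: ler_pM.
rewrite !normrM normr_nat !normrX ler_wpM2l ?mulr_ge0 ?exprn_ge0 //.
by rewrite lerXn2r ?nnegrE.
Qed.

Lemma psum_recl2 c z n : psum c z n.+2 = c 0%N + c 1%N * z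
  + \sum_(k < n) c k.+2 * z ^+ k.+2.
Proof. by rewrite /psum 2!big_ord_recl /= addrA mulr1. Qed.

(** The bound does not depend on [n], which is what lets it pass to the limit:
    it comes from the series of absolute values of the second derivative at
    [r]. *)
Lemma psum_taylor c p M z h r n :
  (forall k, `|diffs (diffs c) k| <= M * 'C(k + p, p)%:R) ->
  `|z| <= r -> `|z + h| <= r -> r < 1 ->
  `|psum c (z + h) n.+2 - psum c z n.+2 - h * psum (diffs c) z n.+1|
    <= `|h| ^+ 2 * (M * (1 - r)^-1 ^+ p.+1).
Proof.
move=> cM zr zhr r1; rewrite !psum_recl2 /psum big_ord_recl /= mulr1.
have -> : c 0%N + c 1%N * (z + h) + \sum_(k < n) c k.+2 * (z + h) ^+ k.+2 -
    (c 0%N + c 1%N * z + \sum_(k < n) c k.+2 * z ^+ k.+2) -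
    h * (diffs c 0 + \sum_(k < n) diffs c k.+1 * z ^+ k.+1) =
  \sum_(k < n) c k.+2 *
    ((z + h) ^+ k.+2 - z ^+ k.+2 - k.+2%:R * h * z ^+ k.+1).
  under [RHS]eq_bigr do rewrite !mulrBr.
  rewrite !sumrB (mulrDr h) (mulr_sumr _ _ _ h) /diffs.
  rewrite [\sum_(k < n) c k.+2 * (k.+2%:R * h * _)](eq_bigr
    (fun k : 'I_n => h * (k.+2%:R * c k.+2 * z ^+ k.+1))); last first.
    by move=> k _; ring.
  ring.
apply: le_trans (ler_norm_sum _ _ _) _.
apply: le_trans (ler_wpM2l _ (sum_norm_expr_le n cM zr r1)); last first.
  by rewrite exprn_ge0.
rewrite mulr_sumr; apply: ler_sum => k _; rewrite normrM /diffs.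
apply: le_trans (ler_wpM2l (normr_ge0 _) (expr_taylor2_le k zr zhr)) _.
by rewrite !normrM !normr_nat natrM le_eqVlt; apply/predU1l; ring.
Qed.

Lemma cvg_norm_le (u : nat -> K^o) (l : K^o) (B : K) :
  u @ \oo --> l -> (forall n, `|u n| <= B) -> `|l| <= B.
Proof.
move=> ul uB; apply/ler_addgt0Pr => e e0.
have /cvgrPdist_lt/(_ _ e0)[n _ /(_ n (leqnn n)) /= lt_e] := ul.
rewrite -[l](subrK (u n)) addrC; apply: le_trans (ler_normD _ _) _.
by rewrite lerD // ltW.
Qed.

(** The limit of the uniform Taylor estimates bounds the error of the
    difference quotient by a multiple of [`|h|]. *)
Lemma derive1_pseries (F : K -> K^o) c z (d : K^o) : poly_growth c ->
  (forall w, `|w| < 1 -> (psum c w : nat -> K^o) @ \oo --> F w) ->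
  `|z| < 1 -> (psum (diffs c) z : nat -> K^o) @ \oo --> d ->
  derive1 F z = d.
Proof.
move=> gc cF z1 cd; have [p [M cM]] := poly_growth_diffs (poly_growth_diffs gc).
(* A radius strictly between that of z and 1. *)
have [zr r1] := midf_lt z1; set r := (_ / 2) in zr r1.
have shift2 (u : nat -> K^o) (l : K^o) :
    u @ \oo --> l -> (fun n => u n.+2) @ \oo --> l.
  by rewrite -(cvg_shiftS u) -(cvg_shiftS (fun n => u n.+1)).
set B := M * (1 - r)^-1 ^+ p.+1.
have taylor h : `|h| <= r - `|z| -> `|F (h + z) - F z - h * d| <= `|h| ^+ 2 * B.
  move=> le_h; have zhr : `|z + h| <= r.
    by rewrite (le_trans (ler_normD _ _)) // addrC -lerBrDr.
  apply: (@cvg_norm_le (fun n => psum c (z + h) n.+2 - psum c z n.+2 -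
      h * psum (diffs c) z n.+1)) => [|n]; last first.
    exact: psum_taylor cM (ltW zr) zhr r1.
  rewrite (addrC h); apply: cvgB; first apply: cvgB.
  - exact: shift2 (cF _ (le_lt_trans zhr r1)).
  - exact: shift2 (cF _ z1).
  - apply: cvgMr.
    by rewrite (cvg_shiftS (psum (diffs c) z : nat -> K^o)).
apply: cvg_lim; first exact: norm_hausdorff.
apply/cvgrPdist_le => e e0.
have B0 : 0 <= B.
  (* At a nonzero increment, a positive multiple of B bounds a norm. *)
  have t0 : 0 < r - `|z| by rewrite subr_gt0.
  have := taylor (r - `|z|); rewrite gtr0_norm // => /(_ (lexx _)).
  by move/(le_trans (normr_ge0 _)); rewrite pmulr_rge0 // exprn_gt0.
near=> h.
have h0 : h != 0 by near: h; apply: nbhs_dnbhs_neq.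
have hr : `|h| <= r - `|z|.
  by apply: ltW; near: h; apply: dnbhs0_lt; rewrite subr_gt0.
have hB : `|h| * (B + 1) <= e.
  rewrite -ler_pdivlMr ?ltr_wpDl //; apply: ltW; near: h; apply: dnbhs0_lt.
  by rewrite divr_gt0 // ltr_wpDl.
have -> : d - h^-1 *: (F (h + z) - F z) = - h^-1 * (F (h + z) - F z - h * d).
  by rewrite /GRing.scale /=; field.
rewrite normrM normrN normfV ler_pdivrMl ?normr_gt0 //.
apply: le_trans (taylor h hr) _; rewrite expr2 -mulrA ler_wpM2l //.
by apply: le_trans hB; rewrite ler_wpM2l // lerDl.
Unshelve. all: by end_near. Qed.

(** The coefficients of degree at least [n] contribute at most a geometric
    tail. *)
Lemma horner_tail_le (p : {poly K}) z n :
  (forall k, `|p`_k| <= 1) -> `|z| < 1 ->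
  `|p.[z] - psum (fun k => p`_k) z n| <= `|z| ^+ n * (1 - `|z|)^-1.
Proof.
move=> p1 z1; rewrite (@horner_coef_wide _ (n + size p)) ?leq_addl //.
rewrite big_split_ord /= addrAC subrr add0r.
apply: le_trans (ler_norm_sum _ _ _) _.
have := @sum_bin_expr_le 0 (size p) `|z| (normr_ge0 z) z1; rewrite expr1.
move/(ler_wpM2l (exprn_ge0 n (normr_ge0 z))); apply: le_trans.
rewrite mulr_sumr; apply: ler_sum => k _; rewrite bin0 mul1r.
by rewrite normrM normrX exprD ler_piMl // mulr_ge0 // exprn_ge0.
Qed.

End PowerSeries.

(** * Convergence of complex series *)

Section ComplexSeries.
Local Open Scope complex_scope.
Variable R : realType.
Local Notation C := R[i].
Local Notation Re := (@complex.Re R).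
Local Notation Im := (@complex.Im R).
Implicit Types (c u : nat -> C) (z h r : C).

Lemma ge_norm_ReIm (z : C) : `|z| <= (`|Re z| + `|Im z|)%:C.
Proof.
rewrite normc_def lecR -ler_sqr ?nnegrE ?sqrtr_ge0 ?addr_ge0 //.
rewrite sqr_sqrtr ?addr_ge0 ?sqr_ge0 // -(real_normK (num_real (Re z))).
rewrite -(real_normK (num_real (Im z))).
have := normr_ge0 (Re z); have := normr_ge0 (Im z); nra.
Qed.

Lemma cvg_ReIm (u : nat -> C) (x y : R) :
  Re \o u @ \oo --> x -> Im \o u @ \oo --> y ->
  (u : nat -> C^o) @ \oo --> (x +i* y : C^o).
Proof.
move=> /cvgrPdist_lt ux /cvgrPdist_lt uy; apply/cvgrPdist_lt => e e0.
have Ee : e = (Re e)%:C by rewrite RRe_real // gtr0_real.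
have {e0}e0 : 0 < Re e / 2 by rewrite divr_gt0 // -ltcR -Ee.
near=> n; apply: le_lt_trans (ge_norm_ReIm _) _; rewrite Ee ltcR.
rewrite (splitr (Re e)) ltrD //.
  have -> : Re (x +i* y - u n : C) = x - Re (u n) by case: (u n).
  by near: n; apply: ux.
have -> : Im (x +i* y - u n : C) = y - Im (u n) by case: (u n).
by near: n; apply: uy.
Unshelve. all: by end_near. Qed.

Lemma bounded_norm_cvg (V : completeNormedModType R) (v : nat -> V) (B : R) :
  (forall n, \sum_(0 <= k < n) `|v k| <= B) -> cvgn (series v).
Proof.
move=> le_B; apply: normed_cvg; apply: nondecreasing_is_cvgn.
  by apply: nondecreasing_series => n _ _ /=.
by exists B => _ [n _ <-]; apply: le_B.
Qed.

(** Real and imaginary parts converge absolutely, by completeness of the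
    reals. *)
Lemma abs_cvg_series (u : nat -> C) (B : C) :
  (forall n, \sum_(0 <= k < n) `|u k| <= B) ->
  exists l : C^o, series (u : nat -> C^o) @ \oo --> l.
Proof.
move=> le_B.
(* [g] stands for the real and the imaginary part. *)
have bnd (g : C -> R) : (forall z, `|g z| <= Re `|z|) ->
    forall n, \sum_(0 <= k < n) `|g (u k)| <= Re B.
  move=> g_le n; apply: le_trans (ler_sum _ (fun k _ => g_le (u k))) _.
  have := le_B n; rewrite lecE => /andP[_]; apply: le_trans.
  by rewrite (raddf_sum (Re : Rcomplex R -> R)).
have leRe z : `|Re z| <= Re `|z|.
  by have := normc_ge_Re z; rewrite lecE => /andP[].
have leIm z : `|Im z| <= Re `|z|.
  rewrite normc_def /= -[leLHS]sqrtr_sqr; apply: ler_wsqrtr.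
  by rewrite lerDr sqr_ge0.
have /cvg_ex[x ux] := bounded_norm_cvg (bnd _ leRe).
have /cvg_ex[y uy] := bounded_norm_cvg (bnd _ leIm).
exists (x +i* y : C); apply: cvg_ReIm.
  apply: cvg_trans ux; apply: near_eq_cvg; near=> n.
  by rewrite /series /= (raddf_sum (Re : Rcomplex R -> R)).
apply: cvg_trans uy; apply: near_eq_cvg; near=> n.
by rewrite /series /= (raddf_sum (Im : Rcomplex R -> R)).
Unshelve. all: by end_near. Qed.

End ComplexSeries.

(** * Maclaurin coefficients of the limit functions *)

Section Maclaurin.
Variable R : realType.
Local Notation C := R[i].
Implicit Types (c : nat -> C) (z : C) (b : nat -> bool).

Lemma psum_cvg c z : poly_growth c -> `|z| < 1 ->
  exists l : C^o, (psum c z : nat -> C^o) @ \oo --> l.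
Proof.
move=> [p [M cM]] z1.
have [|l lP] := @abs_cvg_series R (fun k => c k * z ^+ k)
  (M * (1 - `|z|)^-1 ^+ p.+1).
  move=> n; rewrite big_mkord; under eq_bigr do rewrite normrM normrX.
  exact: sum_norm_expr_le.
exists l; apply: cvg_trans lP; apply: near_eq_cvg; near=> n.
by rewrite /series /= big_mkord.
Unshelve. all: by end_near. Qed.

(** By induction on the order of the derivative, for all series at once: the
    derivative of [F] agrees on the disk with the sum of the differentiated
    series. *)
Lemma maclaurin_pseries (F : C -> C^o) c : poly_growth c ->
  (forall z, `|z| < 1 -> (psum c z : nat -> C^o) @ \oo --> F z) ->
  maclaurin F =1 c.
Proof.
move=> gc cF k; rewrite /maclaurin.
suff -> : derive1n k F 0 = k`!%:R * c k.
  by rewrite mulrAC divff ?mul1r // pnatr_eq0 -lt0n fact_gt0.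
elim: k => [|k IHk] in F c gc cF *.
  rewrite derive1n0 mul1r.
  have F0 := cF 0; rewrite normr0 ltr01 in F0.
  apply: (cvg_unique (@norm_hausdorff _ C^o) (F0 isT)).
  apply: cvg_near_cst; near=> n; have n0 : (0 < n)%N by near: n; exists 1%N.
  rewrite /psum -(prednK n0) big_ord_recl /= mulr1 big1 ?addr0 // => i _.
  by rewrite exprS mul0r mulr0.
rewrite derive1Sn (IHk _ (diffs c)); first 1 last.
- exact: poly_growth_diffs.
- move=> z z1; have [l lP] := psum_cvg (poly_growth_diffs gc) z1.
  by rewrite (derive1_pseries gc cF z1 lP).
by rewrite /diffs mulrA -natrM mulnC -factS.
Unshelve. all: by end_near. Qed.

Lemma norm_stern_coef b k : `|stern_coef C b k| <= 1.
Proof. by case: (stern_coef_01 C b k) => ->; rewrite ?normr0 ?normr1. Qed.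

Lemma poly_growth_stern b : poly_growth (stern_coef C b).
Proof. by exists 0%N, 1 => k; rewrite bin0 mulr1 norm_stern_coef. Qed.

(** The general term of a convergent series, the geometric one. *)
Lemma expr_cvg0 z : `|z| < 1 -> (fun n => z ^+ n : C^o) @ \oo --> (0 : C^o).
Proof.
move=> z1; apply: cvg_series_cvg_0.
have [|l lP] := @psum_cvg (fun=> 1) z _ z1.
  by exists 0%N, 1 => k; rewrite bin0 mulr1 normr1.
apply/cvg_ex; exists l; apply: cvg_trans lP; apply: near_eq_cvg; near=> n.
by rewrite /series /= big_mkord; apply: eq_bigr => k _; rewrite mul1r.
Unshelve. all: by end_near. Qed.

Lemma cvg_exp2n : (fun m => 2 ^ m.+1)%N @ \oo --> \oo.
Proof.
apply/cvgnyPge => A; exists A => // m /= le_Am.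
by apply/ltnW/ltn_exp2/leqW.
Qed.

(** The [m]-th polynomial agrees with the series below degree [2 ^ m.+1], and
    the rest of it is at most a geometric tail. *)
Lemma stern_cvg b z n (l : C^o) : `|z| < 1 -> (0 < n)%N ->
  (psum (stern_coef C b) z : nat -> C^o) @ \oo --> l ->
  (fun m => (stern C (stern_index b n m)).[z] : C^o) @ \oo --> l.
Proof.
move=> z1 n0 lP.
have z1' : `| `|z| | < 1 by rewrite normr_id.
have cpow := cvg_comp _ _ cvg_exp2n (expr_cvg0 z1').
have cpart := cvg_comp _ _ cvg_exp2n lP.
rewrite -[l]add0r.
rewrite (_ : (fun m => _) = (fun m => ((stern C (stern_index b n m)).[z] -
    psum (stern_coef C b) z (2 ^ m.+1)) +
    psum (stern_coef C b) z (2 ^ m.+1) : C^o)); last first.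
  by apply/funext => m; rewrite subrK.
apply: cvgD; last exact: cpart.
apply/cvgr0Pnorm_lt => e e0.
have e1 : 0 < e * (1 - `|z|) by rewrite mulr_gt0 ?subr_gt0.
have /cvgr0Pnorm_lt/(_ _ e1) := cpow; apply: filterS => m /=.
rewrite normrX normr_id -ltr_pdivrMr ?subr_gt0 //; apply: le_lt_trans.
have -> : psum (stern_coef C b) z (2 ^ m.+1) =
    psum (fun k => (stern C (stern_index b n m))`_k) z (2 ^ m.+1).
  by apply: eq_bigr => k _; rewrite coef_stern_index.
apply: horner_tail_le => // k.
by case: (coef_stern_01 C (stern_index b n m) k) => ->; rewrite ?normr0 ?normr1.
Qed.

Lemma psum_stern_lim b z : `|z| < 1 ->
  (psum (stern_coef C b) z : nat -> C^o) @ \oo --> stern_lim b z.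
Proof.
move=> z1; have [l lP] := psum_cvg (poly_growth_stern b) z1.
suff -> : stern_lim b z = l by [].
apply: get_unique => [n n0|w wP]; first exact: stern_cvg.
have w1 := wP 1%N isT; have l1 := stern_cvg z1 (ltn0Sn 0) lP.
exact: (cvg_unique (@norm_hausdorff _ C^o) w1 l1).
Qed.

Lemma maclaurin_stern_lim b : maclaurin (@stern_lim R b) =1 stern_coef C b.
Proof. exact: maclaurin_pseries (poly_growth_stern b) (@psum_stern_lim b). Qed.

End Maclaurin.

Theorem mainTheorem3 (R : realType) (b b' : nat -> bool) :
  (exists k : nat, b k <> b' k) ->
  maclaurin (@stern_lim R b) <> maclaurin (@stern_lim R b').
Proof.
move=> [k bk] E; apply: bk; apply: (@stern_coef_inj R[i]) => j.
by rewrite -!maclaurin_stern_lim E.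
Qed.
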